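(* If $(X,d)$ is a countably generated Lorentzian metric space, then its topology is $\sigma$-compact, second-countable and Polish.
   Context: Let $X$ be a set and $d:X\times X\to[0,+\infty)$ a function. Notation: $x\ll y$ iff $d(x,y)>0$; $I^+(x)=\{y: x\ll y\}$, $I^-(x)=\{y: y\ll x\}$; for $A\subset X$, $I^\pm(A)=\bigcup_{p\in A}I^\pm(p)$ and $I(A)=I^+(A)\cap I^-(A)$; $I(p,q):=I(\{p,q\})$. For $\epsilon>0$, $I_\epsilon=\{(x,y)\in X\times X: d(x,y)\ge\epsilon\}$. $(X,d)$ is a Lorentzian metric space if: (i) $d(x,z)\ge d(x,y)+d(y,z)$ whenever $d(x,y)>0$ and $d(y,z)>0$; (ii) there is a topology $T$ on $X$ such that $d$ is continuous in the product topology and, for every $x,y\in X$ and $\epsilon>0$, the set $I_\epsilon\cap(\overline{I(x,y)}\times\overline{I(x,y)})$ is compact; (iii) $d$ distinguishes points: for all $x\ne y$ there is $z\in X$ with $d(x,z)\ne d(y,z)$ or $d(z,x)\ne d(z,y)$. $(X,d)$ is countably generated if there is a countable subset $\mathscr{G}\subset X$ with $X=I(\mathscr{G})$. A countably generated space has no chronological boundary, i.e. no point $x$ with $d(x,\cdot)\equiv0$ and no point $x$ with $d(\cdot,x)\equiv 0$; for a Lorentzian metric space without chronological boundary the topology $T$ in (ii) is unique, and ''its topology'' means this unique topology. *)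

(* Defs.v *)
From HB Require Import structures.
From mathcomp Require Import all_boot all_order all_algebra.
From mathcomp Require Import all_classical all_reals all_analysis.
Import Order.TTheory GRing.Theory Num.Theory.
Import numFieldNormedType.Exports.

Set Implicit Arguments.
Unset Strict Implicit.
Unset Printing Implicit Defensive.

Local Open Scope classical_set_scope.
Local Open Scope ring_scope.

Section Chronology.
Context {R : realType} {X : Type} (d : X -> X -> R).

Definition Iplus (x : X) : set X := [set y | 0 < d x y].
Definition Iminus (x : X) : set X := [set y | 0 < d y x].

Definition Iplus_set (A : set X) : set X := \bigcup_(p in A) Iplus p.
Definition Iminus_set (A : set X) : set X := \bigcup_(p in A) Iminus p.

Definition Iset (A : set X) : set X := Iplus_set A `&` Iminus_set A.

Definition Ieps (e : R) : set (X * X) := [set p | e <= d p.1 p.2].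

Definition countably_generated : Prop :=
  exists2 G : set X, countable G & [set: X] = Iset G.

End Chronology.

(* [T : Topological X] is a topology on the bare type [X]; the choice and
   equality structures it also contains carry no mathematical content.
   In the compactness clause, [Iset d [set x; y]] is I({x, y}), so neither
   x << y nor y << x is assumed. *)
Definition lorentzian_topology {R : realType} {X : Type} (d : X -> X -> R)
    (T : Topological X) : Prop :=
  let XT : topologicalType := Topological.Pack T in
  continuous (fun p : XT * XT => d p.1 p.2) /\
  (forall (x y : XT) (e : R), 0 < e ->
     compact (Ieps d e `&`
       (closure (Iset d [set x; y] : set XT) `*`
        closure (Iset d [set x; y] : set XT)) : set (XT * XT))).

(* The first clause says that d takes its values in [0, +oo). *)
Definition lorentzian_metric_space {R : realType} {X : Type}
    (d : X -> X -> R) : Prop :=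
  [/\ forall x y, 0 <= d x y,
      forall x y z, 0 < d x y -> 0 < d y z -> d x y + d y z <= d x z,
      exists T : Topological X, lorentzian_topology d T &
      forall x y, x <> y -> exists z, d x z <> d y z \/ d z x <> d z y].

Definition sigma_compact (T : topologicalType) : Prop :=
  exists2 K : nat -> set T,
    forall n, compact (K n) & \bigcup_n K n = [set: T].

Definition separable (T : topologicalType) : Prop :=
  exists2 D : set T, countable D & dense D.

Definition complete_metric (R : realType) (M : metricType R) : Prop :=
  forall u : nat -> M, cauchy (u @ \oo) -> exists x : M, u @ \oo --> x.

(* [m : Metric R T] is a metric on the carrier of [T]; the library's
   [completePseudoMetricType] is not used because it only covers pointed,
   hence nonempty, spaces. *)
Definition completely_metrizable (R : realType) (T : topologicalType) : Prop :=
  exists m : Metric R T,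
    let M : metricType R := Metric.Pack m in
    (forall A : set T, @open T A <-> @open M A) /\ complete_metric M.

Definition polish (R : realType) (T : topologicalType) : Prop :=
  separable T /\ completely_metrizable R T.

(* Main.v *)
(* A diamond [{y | e <= d(p, y), e <= d(y, q)}] is compact; those with [p], [q]
   in the countable generating set yield a continuous weight [h > 0] whose
   superlevel sets [{h >= e}] are relatively compact.  Then
     sup_z min(h(z), |d(x,z) - d(y,z)| + |d(z,x) - d(z,y)|) + |1/h(x) - 1/h(y)|
   is a distance, because [d] distinguishes points; it is continuous, and its
   closed balls are compact, because [1/h] is proper.  A continuous distance
   with compact closed balls induces the topology and is complete. *)
Require Import Defs.
From HB Require Import structures.
From mathcomp Require Import all_boot all_order all_algebra.
From mathcomp Require Import all_classical all_reals all_analysis.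
From mathcomp Require Import lra.
Import Order.TTheory GRing.Theory Num.Theory.
Import numFieldNormedType.Exports.

Set Implicit Arguments.
Unset Strict Implicit.
Unset Printing Implicit Defensive.

Local Open Scope classical_set_scope.
Local Open Scope ring_scope.

(** * Continuous distances with compact closed balls *)

Lemma exists_invn_lt (R : realType) (e : R) : 0 < e -> exists n, n.+1%:R^-1 < e.
Proof.
by move=> e0; have [n] := ltr_add_invr e0; rewrite add0r => ?; exists n.
Qed.

(** Continuity is asked only on the diagonal. That [rho] induces the topology of [T] is not a field;
    it follows from compactness of the closed balls. *)
Record proper_distance (R : realType) (T : topologicalType)
    (rho : T -> T -> R) : Prop := ProperDistance {
  rho_xx : forall x, rho x x = 0 ;
  rho_eq0 : forall x y, rho x y = 0 -> x = y ;
  rho_sym : forall x y, rho x y = rho y x ;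
  rho_triangle : forall y x z, rho x z <= rho x y + rho y z ;
  rho_near : forall x (e : R), 0 < e -> \forall y \near x, rho x y < e ;
  rho_compact : forall x r, compact [set y | rho x y <= r] }.

Section ProperDistanceTheory.
Context (R : realType) (T : topologicalType) (rho : T -> T -> R).
Context (rhoP : proper_distance rho).

Let rho_ge0 x y : 0 <= rho x y.
Proof.
have := rho_triangle rhoP y x x; rewrite (rho_xx rhoP) (rho_sym rhoP y x).
by lra.
Qed.

Lemma nbhs_proper_distance (x : T) (A : set T) :
  nbhs x A <-> exists2 e : R, 0 < e & [set y | rho x y < e] `<=` A.
Proof.
split=> [xA|[e e0 eA]]; last first.
  by apply: filterS eA _; exact: (rho_near rhoP).
(* Every point [y] of the closed unit ball around [x] has a neighbourhood on which, for small [e],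
   [rho x y' < e] implies [A y']: either [y = x] and [A] itself is that neighbourhood, or points
   near [y] stay away from [x]. Compactness makes [e] uniform. *)
have /compact_near_coveringP cov := @rho_compact _ _ _ rhoP x 1.
have [y _|e /= e0 eA] := cov R 0^'+ (fun e y => rho x y < e -> A y) _.
- have [<-|xy] := pselect (x = y).
    by near=> y' e => /= _; near: y'.
  have d0 : 0 < rho x y / 2.
    rewrite divr_gt0// lt_neqAle rho_ge0 andbT eq_sym.
    by apply/eqP => /(rho_eq0 rhoP).
  near=> y' e => /= xe; exfalso.
  have : rho y y' < rho x y / 2 by near: y'; exact: (rho_near rhoP).
  have : e < rho x y / 2 by near: e; exact: nbhs_right_lt.
  by have := rho_triangle rhoP y' x y; rewrite (rho_sym rhoP y' y); lra.
(* The bound 1 keeps [y] in the compact ball; halving puts the radius strictly inside the range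
   given by the filter [0^'+]. *)
- exists (Num.min (e / 2) 1).
    by rewrite lt_min divr_gt0//=.
  move=> y /=; rewrite lt_min => /andP[ye y1].
  have := eA (e / 2); rewrite /= sub0r normrN gtr0_norm ?divr_gt0//.
  move=> /(_ _ _ y).
  apply => //; last exact: ltW.
    by rewrite ltr_pdivrMr// ltr_pMr// ltr1n.
Unshelve. all: by end_near. Qed.

Lemma proper_distance_sigma_compact : sigma_compact T.
Proof.
have [[x0 _]|T0] := pselect (exists x : T, True).
  exists (fun n => [set y | rho x0 y <= n%:R]) => [n|].
    exact: (rho_compact rhoP).
  rewrite -subTset => y _; exists (Num.truncn (rho x0 y)).+1 => //=.
  exact/ltW/truncnS_gt.
exists (fun=> set0) => [n|]; first exact: compact0.
by rewrite -subTset => y _; case: T0; exists y.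
Qed.

Lemma compact_totally_bounded (K : set T) (e : R) : 
    0 < e -> compact K ->
  exists s : seq T, K `<=` [set y | exists2 a, a \in s & rho a y < e].
Proof.
move=> e0 /compact_near_coveringP.
(* Along the filter of ever larger lists, each point is eventually one of the centres, and then so
   are its neighbours' approximations; near covering yields one list that serves all of [K]. *)
pose F := filter_from [set: seq T] (fun s =>
  [set s' : seq T | {subset s <= s'}]).
have FF : Filter F.
  apply: filter_from_filter; first by exists [::].
  move=> s t _ _; exists (s ++ t) => // u /= stu.
  by split=> a as_; apply: stu; rewrite mem_cat as_ ?orbT.
move=> /(_ _ F (fun s y => exists2 a, a \in s & rho a y < e) _).
case=> [x Kx|s _ sK]; last first.
  by exists s; apply: sK => /=.
exists ([set y | rho x y < e], [set s | x \in s]) => /=.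
  split; first exact: (rho_near rhoP).
  by exists [:: x] => // s /= /(_ x (mem_head _ _)).
by move=> [y s] /= [xy xs]; exists x.
Qed.

(** [D] collects the finite nets of mesh [m.+1%:R^-1] of countably many compact sets covering
    [T]. *)
Lemma proper_distance_countable_dense :
  exists2 D : set T, countable D &
    forall x (e : R), 0 < e -> exists2 a, D a & rho a x < e.
Proof.
have [K Kc KT] := proper_distance_sigma_compact.
pose net n m := cid (compact_totally_bounded (e := m.+1%:R^-1 : R) ltac:(by [])
  (Kc n)).
exists (\bigcup_n \bigcup_m [set` sval (net n m)]).
  apply: bigcup_countable => // n _; apply: bigcup_countable => // m _.
  exact/finite_set_countable/finite_seq.
move=> x e /exists_invn_lt[m me].
have [n _ Knx] : (\bigcup_n K n) x by rewrite KT.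
have [a an ax] := svalP (net n m) _ Knx.
by exists a; [exists n => //; exists m | exact: lt_trans me].
Qed.

Lemma open_proper_ball a (e : R) : open [set y | rho a y < e].
Proof.
rewrite openE => y /= ay; apply/nbhs_proper_distance.
exists (e - rho a y) => [|z /= yz]; first by rewrite subr_gt0.
by have := rho_triangle rhoP y a z; lra.
Qed.

Lemma proper_distance_second_countable : @second_countable T.
Proof.
have [D Dc DT] := proper_distance_countable_dense.
exists (\bigcup_(a in D) \bigcup_n [set [set y | rho a y < n.+1%:R^-1]]).
  by apply: bigcup_countable => // a _; exact: bigcup_countable.
split=> [_ [a _ [n _ ->]]|x A /nbhs_proper_distance[e e0 eA]].
  exact: open_proper_ball.
have [n ne] := exists_invn_lt (divr_gt0 e0 (ltr0Sn R 1)).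
have [a Da ax] := DT x n.+1%:R^-1 ltac:(by []).
exists [set y | rho a y < n.+1%:R^-1].
  by split=> //; exists a => //; exists n.
apply: subset_trans eA => y /=; move: (n.+1%:R^-1 : R) ax ne => c ax ne ay.
by have := rho_triangle rhoP a x y; rewrite (rho_sym rhoP x a); lra.
Qed.

Lemma proper_distance_separable : separable T.
Proof.
have [D Dc DT] := proper_distance_countable_dense.
exists D => // O [x Ox] Oo.
have /nbhs_proper_distance[e e0 eO] : nbhs x O by exact: open_nbhs_nbhs.
have [a Da ax] := DT x e e0.
by exists a; split=> //; apply: eO; rewrite /= (rho_sym rhoP).
Qed.

(** This alias carries the topology generated by [rho], kept apart from that of [T] until
    [nbhs_metric] identifies the two. *)
Let metric : Type := T.
HB.instance Definition _ := Choice.on metric.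
HB.instance Definition _ := @isMetric.Build R metric rho
  (rho_xx rhoP) (rho_eq0 rhoP) (rho_sym rhoP) (rho_triangle rhoP).

Let nbhs_metric (x : metric) : @nbhs _ metric x = @nbhs _ T x.
Proof.
apply/seteqP; split=> A.
  by move=> /nbhs_ballP[e /= e0 eA]; apply/nbhs_proper_distance; exists e => //;
    move: eA; rewrite ballEmdist.
by move=> /nbhs_proper_distance[e e0 eA]; apply/nbhs_ballP; exists e => //;
  rewrite ballEmdist.
Qed.

(** A Cauchy sequence eventually stays in a closed unit ball around one of its terms. By compactness
    it has a cluster point there, which is then its limit. *)
Let complete_metric_metric : complete_metric metric.
Proof.
move=> u /cauchy_ballP cu.
have [/= [A B] [[n _ nA] [m _ mB]] AB] := cu 1 ltr01.
have := @rho_compact _ _ _ rhoP (u n) 1 (u @ \oo) _.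
case=> [|x [_ xu]].
  exists m => // k /= mk; apply/ltW.
  have := AB (u n, u k) (conj (nA n (leqnn n)) (mB k mk)).
  by rewrite ballEmdist.
exists x; apply/cvg_ballP => e e0.
have [/= [A' B'] [A'u B'u] AB'] := cu (e / 2) (divr_gt0 e0 (ltr0Sn R 1)).
have [y [A'y xy]] := xu A' [set y | rho x y < e / 2] A'u
  (rho_near rhoP x (divr_gt0 e0 (ltr0Sn R 1))).
apply: filterS B'u => k /= B'k; rewrite ballEmdist /=.
have := AB' (y, k) (conj A'y B'k); rewrite ballEmdist /=.
by have := rho_triangle rhoP y x k; move: xy; rewrite /mdist/=; lra.
Qed.

Lemma proper_distance_polish : polish R T.
Proof.
split; first exact: proper_distance_separable.
exists (Metric.on metric); split; last exact: complete_metric_metric.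
move=> A; rewrite !openE /interior /=.
by split=> oA x /oA; rewrite nbhs_metric.
Qed.

End ProperDistanceTheory.

(** * From a vanishing weight to a proper distance *)

Section WeightedDistance.
Context (R : realType) (T : topologicalType) (d : T -> T -> R) (h : T -> R).
Context (x0 : T).
Context (d_cont : continuous (fun p : T * T => d p.1 p.2)).
Context (d_dist : forall x y, x <> y ->
  exists z, d x z <> d y z \/ d z x <> d z y).
Context (h_gt0 : forall z, 0 < h z) (h_le1 : forall z, h z <= 1).
Context (h_cont : continuous h).
Context (h_vanish : forall e : R, 0 < e ->
  exists2 K, compact K & [set z | e <= h z] `<=` K).

Let cvg_d S (F : set_system S) {FF : Filter F} (f g : S -> T) x y :
  f @ F --> x -> g @ F --> y -> d (f s) (g s) @[s --> F] --> d x y.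
Proof.
by move=> fx gy; exact: (cvg_comp _ _ (cvg_pair fx gy) (@d_cont (x, y))).
Qed.

Let gap x y z : R := `|d x z - d y z| + `|d z x - d z y|.

Let gap_ge0 x y z : 0 <= gap x y z.
Proof. by rewrite addr_ge0. Qed.

(* Capping the gap at [z] by [h z] makes the supremum finite, and continuous in
   [x] and [y] because only a compact set of [z] matters up to a given error. *)
Let wdist x y := sup (range (fun z => Num.min (h z) (gap x y z))).

Let wdist_ub x y z : Num.min (h z) (gap x y z) <= wdist x y.
Proof.
have ub : has_ubound (range (fun z => Num.min (h z) (gap x y z))).
  by exists 1 => _ [t _ <-]; rewrite ge_min h_le1.
by apply: (ub_le_sup ub); exists z.
Qed.

Let wdist_le x y (c : R) :
  (forall z, Num.min (h z) (gap x y z) <= c) -> wdist x y <= c.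
Proof.
move=> le_c; apply: ge_sup => [|_ [z _ <-]//].
by exists (Num.min (h x0) (gap x y x0)), x0.
Qed.

Let wdist_xx x : wdist x x = 0.
Proof.
have gap0 z : gap x x z = 0 by rewrite /gap !subrr normr0 addr0.
apply/le_anti/andP; split; last first.
  by have := wdist_ub x x x0; rewrite gap0 min_r// ltW.
by apply: wdist_le => z; rewrite gap0 ge_min lexx orbT.
Qed.

Let wdist_ge0 x y : 0 <= wdist x y.
Proof. by apply: le_trans (wdist_ub x y x0); rewrite le_min gap_ge0 ltW. Qed.

Let wdist_sym x y : wdist x y = wdist y x.
Proof.
suff gapC : gap x y = gap y x by rewrite /wdist gapC.
by apply/funext => z; rewrite /gap (distrC (d x z)) (distrC (d z x)).
Qed.

(** The gap satisfies the triangle inequality at each [t], and truncation at the level [h t > 0]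
    preserves it. *)
Let wdist_triangle y x z : wdist x z <= wdist x y + wdist y z.
Proof.
apply: wdist_le => t; apply: le_trans (lerD (wdist_ub x y t) (wdist_ub y z t)).
have : gap x z t <= gap x y t + gap y z t.
  rewrite addrACA; apply: lerD; exact: ler_distD.
have := gap_ge0 x y t; have := gap_ge0 y z t; have := h_gt0 t.
by rewrite /Num.min; do 3!case: ifPn => //; rewrite -?leNgt; lra.
Qed.

Let wdist_eq0 x y : wdist x y = 0 -> x = y.
Proof.
move=> xy0; apply: contrapT => /d_dist[z dz].
have := wdist_ub x y z; rewrite xy0 leNgt lt_min h_gt0/= => /negP; apply.
case: dz => dz; [apply: ltr_wpDr => //|apply: ltr_wpDl => //];
  by rewrite normr_gt0 subr_eq0; apply/eqP.
Qed.

Let wdist_near x (e : R) : 0 < e -> \forall y \near x, wdist x y < e.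
Proof.
move=> e0; have e20 : 0 < e / 2 by rewrite divr_gt0.
have [K /compact_near_coveringP cov Kh] := h_vanish e20.
(* The gap is jointly continuous and vanishes at [y = x], so compactness of [K] gives one
   neighbourhood of [x] for all [z] in [K]. Off [K], the cap [h z < e / 2] is enough. *)
have gap_small : \forall y \near x, K `<=` [set z | gap x y z < e / 2].
  apply: (cov T (nbhs x) (fun y z => gap x y z < e / 2)) => z _.
  have fz : p.1 @[p --> (z, x)] --> z by exact: cvg_fst.
  have sx : p.2 @[p --> (z, x)] --> x by exact: cvg_snd.
  have dxz : d x p.1 @[p --> (z, x)] --> d x z.
    by apply: cvg_d fz; exact: cvg_cst.
  have dyz : d p.2 p.1 @[p --> (z, x)] --> d x z by exact: cvg_d sx fz.
  have dzx : d p.1 x @[p --> (z, x)] --> d z x.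
    by apply: cvg_d fz _; exact: cvg_cst.
  have dzy : d p.1 p.2 @[p --> (z, x)] --> d z x by exact: cvg_d fz sx.
  have gap0 : gap x p.2 p.1 @[p --> (z, x)] --> (0 : R).
    have -> : 0 = `|d x z - d x z| + `|d z x - d z x| :> R.
      by rewrite !subrr normr0 addr0.
    by apply: cvgD; apply: cvg_norm; apply: cvgB.
  exact: (cvgr_lt 0 gap0 _ e20).
apply: filterS gap_small => y yK.
apply: (@le_lt_trans _ _ (e / 2)); last first.
  by rewrite ltr_pdivrMr// ltr_pMr// ltr1n.
apply: wdist_le => z; rewrite ge_min.
have [/Kh/yK/ltW ->|/ltW ->//] := leP (e / 2) (h z).
by rewrite orbT.
Qed.

Lemma proper_distance_of_vanishing_weight :
  exists rho : T -> T -> R, proper_distance rho.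
Proof.
pose rho x y := wdist x y + `|(h x)^-1 - (h y)^-1|.
have rho_triangle y x z : rho x z <= rho x y + rho y z.
  by rewrite /rho addrACA lerD// ler_distD.
have rho_near x (e : R) : 0 < e -> \forall y \near x, rho x y < e.
  move=> e0; have e20 : 0 < e / 2 by rewrite divr_gt0.
  have hV : (h y)^-1 @[y --> x] --> (h x)^-1.
    by apply: cvgV; [rewrite gt_eqF|exact: h_cont].
  near=> y; rewrite /rho (splitr e) ltrD//.
    by near: y; exact: wdist_near.
  by near: y; move/cvgrPdist_lt : hV; exact.
exists rho; split=> //.
- by move=> x; rewrite /rho wdist_xx subrr normr0 addr0.
- move=> x y xy0; apply: wdist_eq0; apply/le_anti.
  by rewrite wdist_ge0 andbT -xy0 lerDl.
- by move=> x y; rewrite /rho wdist_sym distrC.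
(* On the ball, [(h y)^-1 <= r + (h x)^-1 <= c], hence [h y >= c^-1]. The absolute value keeps [c]
   positive when [r] is negative. *)
- move=> x r; set c := `|r| + (h x)^-1.
  have c0 : 0 < c by rewrite ltr_wpDl// invr_gt0.
  have [K Kc Kh] := h_vanish (e := c^-1) ltac:(by rewrite invr_gt0).
  apply: subclosed_compact Kc _; last first.
    move=> y /= xy; apply: Kh => /=.
    rewrite -[leRHS]invrK lef_pV2 ?posrE ?invr_gt0// /c -lerBlDr.
    apply: le_trans (ler_norm r); apply: le_trans xy.
    apply: (@le_trans _ _ `|(h x)^-1 - (h y)^-1|); last by rewrite lerDr.
    by rewrite distrC ler_norm.
  rewrite -openC openE => y /= /negP; rewrite -ltNge => xy.
  have yxr : 0 < rho x y - r by rewrite subr_gt0.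
  have rho_sym u v : rho u v = rho v u by rewrite /rho wdist_sym distrC.
  apply: filterS (rho_near y _ yxr) => z /= yz; apply/negP; rewrite -ltNge.
  by have := rho_triangle z x y; rewrite (rho_sym z); lra.
Unshelve. all: by end_near. Qed.

End WeightedDistance.

(** * The weight of a countable generating set *)

Section ChronologicalWeight.
Context (R : realType) (T : topologicalType) (d : T -> T -> R) (G : set T).
Context (d_ge0 : forall x y, 0 <= d x y).
Context (d_triangle : forall x y z,
  0 < d x y -> 0 < d y z -> d x y + d y z <= d x z).
Context (d_cont : continuous (fun p : T * T => d p.1 p.2)).
Context (d_compact : forall (x y : T) (e : R), 0 < e ->
  compact (Ieps d e `&` (closure (Iset d [set x; y]) `*`
                         closure (Iset d [set x; y])))).
Context (G_countable : countable G) (G_gen : [set: T] = Iset d G).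

Let chron_past x : exists2 p, G p & 0 < d p x.
Proof.
by have [[p Gp px] _] : Iset d G x by [rewrite -G_gen]; exists p.
Qed.

Let chron_future x : exists2 q, G q & 0 < d x q.
Proof.
by have [_ [q Gq xq]] : Iset d G x by [rewrite -G_gen]; exists q.
Qed.

Let d_contr p : continuous (d p).
Proof.
move=> x; have px : (p, y) @[y --> x] --> (p, x).
  by apply: cvg_pair; [exact: cvg_cst|exact: cvg_id].
exact: (cvg_comp _ _ px (@d_cont (p, x))).
Qed.

Let d_contl q : continuous (d^~ q).
Proof.
move=> x; have xq : (y, q) @[y --> x] --> (x, q).
  by apply: cvg_pair; [exact: cvg_id|exact: cvg_cst].
exact: (cvg_comp _ _ xq (@d_cont (x, q))).
Qed.

(* With [q << q'], both this set and [q] lie in [I(p, q')], so the set is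
   contained in the projection of the compact [I_e] over [I(p, q')]. *)
Let diamond_compact p q (e : R) : 0 < e ->
  compact [set y | e <= d p y /\ e <= d y q].
Proof.
move=> e0; have [q' _ qq'] := chron_future q.
apply: (@subclosed_compact _ _ [set z.1 | z in Ieps d e `&`
  (closure (Iset d [set p; q']) `*` closure (Iset d [set p; q']))]).
- apply: closedI.
  + apply: (@preimage_closed _ _ (d p) [set r | e <= r]) => [x _|].
      exact: d_contr.
    exact: closed_ge.
  + apply: (@preimage_closed _ _ (d^~ q) [set r | e <= r]) => [x _|].
      exact: d_contl.
    exact: closed_ge.
- apply: (@continuous_compact _ _ fst); last exact: d_compact.
  by apply: continuous_subspaceT => z; exact: cvg_fst.
- move=> y [/= py yq].
  have py0 : 0 < d p y := lt_le_trans e0 py.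
  have yq0 : 0 < d y q := lt_le_trans e0 yq.
  have pq0 : 0 < d p q by have := d_triangle py0 yq0; lra.
  have yq'0 : 0 < d y q' by have := d_triangle yq0 qq'; lra.
  exists (y, q) => //; split=> //; split=> /=; apply: subset_closure.
    by split; [exists p; [left|] | exists q'; [right|]].
  by split; [exists p; [left|] | exists q'; [right|]].
Qed.

(** Take the supremum over [k] of [d (pq k).1 z] and [d z (pq k).2], both capped by [k.+1%:R^-1],
    where [pq] enumerates the pairs from [G]. Generation makes it positive; the shrinking caps leave
    only finitely many [k] relevant up to a given error. *)
Lemma chronological_weight (x0 : T) : exists h : T -> R,
  [/\ forall z, 0 < h z, forall z, h z <= 1, continuous h &
    forall e : R, 0 < e -> exists2 K, compact K & [set z | e <= h z] `<=` K].
Proof.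
have [pq pqP] : exists pq : nat -> T * T,
    forall p q, G p -> G q -> exists k, pq k = (p, q).
  have /pfcard_geP[GG0|[pq]] := countableX G_countable G_countable.
    have [p Gp _] := chron_past x0.
    by have : (G `*` G) (p, p) by []; rewrite GG0.
  exists pq => p q Gp Gq.
  have [k _ <-] := @surj _ _ _ _ pq (p, q) (conj Gp Gq).
  by exists k.
pose w z k : R := Num.min k.+1%:R^-1 (Num.min (d (pq k).1 z) (d z (pq k).2)).
have w_ge0 z k : 0 <= w z k by rewrite !le_min !d_ge0 invr_ge0 ler0n.
have w_le z k : w z k <= k.+1%:R^-1 by rewrite ge_min lexx.
have w_le1 z k : w z k <= 1.
  by apply: le_trans (w_le z k) _; rewrite invf_le1// ler1n.
have w_cont k : continuous (w^~ k).
  move=> z; apply: (@continuous_min R T (fun=> k.+1%:R^-1)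
    (fun y => Num.min (d (pq k).1 y) (d y (pq k).2))); first exact: cvg_cst.
  by apply: (@continuous_min R T (d (pq k).1) (d^~ (pq k).2));
    [exact: d_contr|exact: d_contl].
pose h z := sup (range (w z)).
have w_le_h z k : w z k <= h z.
  have ub : has_ubound (range (w z)) by exists 1 => _ [j _ <-].
  by apply: (ub_le_sup ub); exists k.
have h_le z c : (forall k, w z k <= c) -> h z <= c.
  by move=> le_c; apply: ge_sup => [|_ [k _ <-]//]; exists (w z 0%N), 0%N.
exists h; split=> [z|z|x|e e0].
- have [p Gp pz] := chron_past z; have [q Gq zq] := chron_future z.
  have [k pqk] := pqP p q Gp Gq; apply: lt_le_trans (w_le_h z k).
  by rewrite /w pqk !lt_min pz zq invr_gt0 ltr0n.
- exact: h_le.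
(* For [k >= N] both terms lie in an interval of length less than [e], so only the indices below [N]
   restrict the neighbourhood. *)
- apply/cvgrPdist_le => e e0; have [N Ne] := exists_invn_lt e0.
  have near_w : \forall y \near x, forall k : 'I_N, `|w x k - w y k| < e.
    by apply: filter_forall => k; move/cvgrPdist_lt : (w_cont k x); exact.
  apply: filterS near_w => y wxy.
  have {}wxy k : `|w x k - w y k| <= e.
    have [kN|Nk] := ltnP k N; first exact/ltW/(wxy (Ordinal kN)).
    have : k.+1%:R^-1 < e.
      by apply: le_lt_trans Ne; rewrite lef_pV2 ?posrE// ler_nat.
    have := w_ge0 x k; have := w_ge0 y k; have := w_le x k; have := w_le y k.
    by rewrite ler_norml; move: (k.+1%:R^-1 : R) => c; lra.
  rewrite ler_distlC; apply/andP; split.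
    rewrite lerBlDr; apply: h_le => k; have := wxy k; have := w_le_h y k.
    by rewrite ler_norml; lra.
  apply: h_le => k; have := wxy k; have := w_le_h x k.
  by rewrite ler_norml; lra.
(* The supremum may not be attained, so [e <= h z] is weakened to some [w z k > e / 2]. The cap then
   forces [k < N], and [z] lies in one of finitely many compact diamonds. *)
- have [N Ne] := exists_invn_lt (divr_gt0 e0 (ltr0Sn R 1)).
  exists (\big[setU/set0]_(k < N) [set y | e / 2 <= d (pq k).1 y /\
                                           e / 2 <= d y (pq k).2]).
    by apply: bigsetU_compact => k _; apply: diamond_compact; rewrite divr_gt0.
  move=> z /= ez; rewrite -(bigcup_mkord _ (fun k => [set y |
    e / 2 <= d (pq k).1 y /\ e / 2 <= d y (pq k).2])).
  have : e / 2 < h z by lra.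
  move=> /sup_gt[|_ [k _ <-]]; first by exists (w z 0%N), 0%N.
  rewrite !lt_min => /andP[ke /andP[pz zq]]; exists k => /=.
    by have := lt_trans Ne ke; rewrite ltf_pV2 ?posrE// ltr_nat ltnS.
  by split; exact: ltW.
Qed.

End ChronologicalWeight.

Theorem proposition3p20 (R : realType) (X : Type) (d : X -> X -> R) :
  lorentzian_metric_space d -> countably_generated d ->
  forall T : Topological X, lorentzian_topology d T ->
  let XT : topologicalType := Topological.Pack T in
  [/\ sigma_compact XT, @second_countable XT & polish R XT].
Proof.
move=> [d_ge0 d_triangle _ d_dist] [G Gc Ggen] T [d_cont d_compact] XT.
have [rho rhoP] : exists rho : XT -> XT -> R, proper_distance rho.
  (* The suprema above need a point; on the empty space any function is a proper distance. *)
  have [[x0 _]|X0] := pselect (exists x : XT, True); last first.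
    by exists (fun=> fun=> 0); split=> x; case: X0; exists x.
  have [h [h_gt0 h_le1 h_cont h_vanish]] := @chronological_weight R XT d G d_ge0
    d_triangle d_cont d_compact Gc Ggen x0.
  exact: (@proper_distance_of_vanishing_weight R XT d h x0).
split; [exact: proper_distance_sigma_compact rhoP
       |exact: proper_distance_second_countable rhoP
       |exact: proper_distance_polish rhoP].
Qed.
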